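(* Let $\alpha\in(0,1]$, $l>0$, let $E,I,P>0$ be constants, put $\lambda:=\dfrac{P}{EI\,\Gamma(2-\alpha)}$, and let $b_1\in\mathbb{R}$. Define $$a_0:=1,\qquad a_k:=\prod_{i=1}^{k}\frac{\Gamma(2i+1-\alpha)}{\Gamma(2i+2)},\quad k\in\mathbb{N}=\{1,2,\dots\},$$ and $$y(x)=b_1\Big(a_0\,x+\sum_{k=1}^{\infty}(-1)^k a_k\lambda^k x^{2k+1}\Big),\qquad x\in\mathbb{R}.$$ Then the series converges absolutely for every $x\in\mathbb{R}$, and $y$ represents the solution of the initial value problem $$D_{0+}^{1+\alpha}y(x)=-\lambda x^{1-\alpha}\,y(x),\quad x\in(0,l),\qquad y(0)=0,\quad y'(0)=b_1;$$ that is, $y$ satisfies this equation and these initial conditions.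
   Context: For $\beta\in(0,\infty)\setminus\mathbb{N}$, the left-sided Caputo fractional derivative of a smooth function $y:[0,l]\to\mathbb{R}$ is $$(D_{0+}^{\beta}y)(x)=\frac{1}{\Gamma(n-\beta)}\int_0^x\frac{y^{(n)}(t)}{(x-t)^{\beta-n+1}}\,dt,\qquad n=[\beta]+1,$$ where $[\beta]$ is the integer part of $\beta$. For $\alpha=1$, $D_{0+}^{2}y$ denotes the ordinary second derivative $y''$. $\Gamma$ is the Euler gamma function. *)

(* Defs.v *)
From HB Require Import structures.
From mathcomp Require Import all_boot all_order all_algebra.
From mathcomp Require Import all_classical all_reals all_analysis.

Set Implicit Arguments.
Unset Strict Implicit.
Unset Printing Implicit Defensive.

Import Order.TTheory GRing.Theory Num.Theory.
Import numFieldNormedType.Exports.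

Local Open Scope ring_scope.
Local Open Scope classical_set_scope.

(* Euler's integral; it is the gamma function only for [0 < s], the only range
   in which it is used below. *)
Definition Gamma (R : realType) (s : R) : R :=
  \int[lebesgue_measure]_(t in `]0, +oo[) (t `^ (s - 1) * expR (- t)).

Definition smooth (R : realType) (y : R -> R) : Prop :=
  forall (k : nat) (x : R), derivable (y^`(k)) x 1.

(* [Num.truncn beta] is the integer part of [beta] for [0 <= beta]. *)
Definition caputo_order (R : realType) (beta : R) : nat := (Num.truncn beta).+1.

(* At [t = x] the power takes a conventional value, irrelevant to the integral. *)
Definition caputo_integrand (R : realType) (beta : R) (y : R -> R) (x t : R) : R :=
  let n := caputo_order beta in
  (y^`(n))%classic t / (x - t) `^ (beta - n%:R + 1).

(* The left-sided Caputo derivative based at 0; for a natural number [beta] it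
   is by convention the ordinary derivative of order [beta]. *)
Definition caputo (R : realType) (beta : R) (y : R -> R) (x : R) : R :=
  if beta == (Num.truncn beta)%:R then (y^`(Num.truncn beta))%classic x
  else (Gamma ((caputo_order beta)%:R - beta))^-1 *
       \int[lebesgue_measure]_(t in `[0, x]) caputo_integrand beta y x t.

(* [derive1n] and the integral are total functions, so the meaningfulness of
   [caputo beta y x] has to be asserted separately. *)
Definition caputo_defined (R : realType) (beta : R) (y : R -> R) (x : R) : Prop :=
  smooth y /\
  (beta != (Num.truncn beta)%:R ->
   lebesgue_measure.-integrable `[0, x] (EFin \o caputo_integrand beta y x)).

(* The empty product gives [acoef alpha 0 = 1]. *)
Definition acoef (R : realType) (alpha : R) (k : nat) : R :=
  \prod_(1 <= i < k.+1)
    (Gamma ((2 * i + 1)%:R - alpha) / Gamma ((2 * i + 2)%:R)).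

Definition yterm (R : realType) (alpha lambda x : R) (k : nat) : R :=
  (-1) ^+ k * acoef alpha k * lambda ^+ k * x ^+ (2 * k + 1).

Definition ysol (R : realType) (alpha lambda b1 x : R) : R :=
  b1 * (acoef alpha 0 * x +
        limn (fun n : nat => \sum_(1 <= k < n) yterm alpha lambda x k)).

(* Main.v *)
Require Import Defs.
From mathcomp Require Import all_boot all_order all_algebra.
From mathcomp Require Import all_classical all_reals all_analysis.
From mathcomp Require Import measurable_realfun ring.
Import Order.TTheory GRing.Theory Num.Theory.
Import numFieldNormedType.Exports.
Local Open Scope ring_scope.
Local Open Scope classical_set_scope.

(* Write y(x) as a power series with coefficients c_n, and call s = 1 - alpha.
   For alpha < 1 the Caputo derivative of y is the Riemann-Liouville fractional
   integral of order s of y'', and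
     int_0^x t^m (x - t)^(s-1) dt = m! Gamma(s) / Gamma(s+m+1) x^(s+m),
   so integrating y'' termwise (dominated convergence) turns the equation into
   the recurrence c_{n+2} Gamma(n+3) = - lambda c_n Gamma(n+2-alpha), which is
   how the a_k are defined; at alpha = 1 the same recurrence gives y'' = - lambda y.
   Convergence follows from a_k <= 1/k!, a consequence of
   Gamma(u) <= Gamma(n+1) + Gamma(n+2) for n+1 <= u <= n+2. *)

Set Implicit Arguments.
Unset Strict Implicit.

(** * Entire power series *)

Definition entire (R : realType) (c : R^nat) := forall x : R, cvgn (pseries c x).

(** Convergence at [|x| + 1] forces absolute convergence at the strictly smaller radius [|x|]. *)
Lemma entire_norm (R : realType) (c : R^nat) (x : R) :
  entire c -> cvgn (pseries (fun i => `|c i|) x).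
Proof.
move=> /(_ (`|x| + 1))/is_cvg_pseries_inside_norm; apply.
by rewrite [ltRHS]ger0_norm ?addr_ge0// ltrDl.
Qed.

(** With [r = |x| + 1], the bounds [n + 1 <= 2^(n+1)] and [|x|^n <= r^(n+1)] dominate the n-th term
    by the (n+1)-st term of the absolute series at [2 * r]. *)
Lemma entire_pseries_diffs (R : realType) (c : R^nat) :
  entire c -> entire (pseries_diffs c).
Proof.
move=> ec x; apply: normed_cvg.
pose r : R := `|x| + 1.
have r1 : 1 <= r by rewrite lerDr.
have r0 : 0 <= r by exact: le_trans r1.
pose u i : R := `|c i| * (2 * r) ^+ i.
have /cvg_ex[l ul] : cvgn (series u) := entire_norm (x := 2 * r) ec.
have {}ul : cvgn (series (fun i => u i.+1)).
  apply/cvg_ex; exists (l - u 0).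
  rewrite (_ : series _ = (fun n => series u n.+1 - u 0)).
    by apply: cvgB; [rewrite (cvg_shiftS (series u)) | exact: cvg_cst].
  by apply/funext => n; rewrite /series/= [in RHS]big_nat_recl// addrC addKr.
apply: series_le_cvg ul => [n|n|n] /=; first exact: normr_ge0.
  by rewrite mulr_ge0// exprn_ge0// mulr_ge0.
rewrite /u /pseries_diffs !normrM normr_nat normrX [_ * `|c _|]mulrC -mulrA ler_wpM2l//.
rewrite exprMn ler_pM// ?exprn_ge0//.
  by rewrite -natrX ler_nat ltnW// ltn_expl.
rewrite (@le_trans _ _ (r ^+ n))//.
  by apply: lerXn2r; rewrite ?nnegrE// lerDl.
exact: ler_weXn2l.
Qed.

Lemma is_derive_pseries (R : realType) (c : R^nat) (x : R) : entire c ->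
  is_derive x 1 (fun z => limn (pseries c z)) (limn (pseries (pseries_diffs c) x)).
Proof.
move=> ec; apply: (@pseries_snd_diffs _ _ (`|x| + 1)).
- exact: ec.
- exact: entire_pseries_diffs.
- by do 2 apply: entire_pseries_diffs.
- by rewrite [ltRHS]ger0_norm ?addr_ge0// ltrDl.
Qed.

Lemma entire_iter (R : realType) (c : R^nat) k : entire c ->
  entire (iter k (@pseries_diffs R) c).
Proof. by move=> ec; elim: k => //= k; exact: entire_pseries_diffs. Qed.

Lemma derive1n_pseries (R : realType) (c : R^nat) k : entire c ->
  ((fun z => limn (pseries c z))^`(k))%classic =
  fun z => limn (pseries (iter k (@pseries_diffs R) c) z).
Proof.
move=> ec; elim: k => [//|k IH]; rewrite derive1nS {}IH.
apply/funext => x; rewrite derive1E.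
by have /@derive_val := is_derive_pseries x (entire_iter (k := k) ec).
Qed.

Lemma smooth_pseries (R : realType) (c : R^nat) : entire c ->
  smooth (fun z => limn (pseries c z)).
Proof.
move=> ec k x; rewrite derive1n_pseries//.
by have /@ex_derive := is_derive_pseries x (entire_iter (k := k) ec).
Qed.

(** * Improper integrals and the gamma function *)

Section improper_integrals.
Context {R : realType}.
Notation mu := (@lebesgue_measure R).

Lemma FTC2_is_derive (f F : R -> R) (a b : R) : a < b ->
    (forall x : R, a <= x <= b -> is_derive x 1 F (f x)) ->
    (forall x : R, a <= x <= b -> derivable f x 1) ->
  (\int[mu]_(x in `[a, b]) (f x)%:E = (F b - F a)%:E)%E.
Proof.
move=> ab dF df.
have cf : {within `[a, b], continuous f}.
  by apply: derivable_within_continuous => x; rewrite in_itv/=; exact: df.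
have cF : {within `[a, b], continuous F}.
  by apply: derivable_within_continuous => x; rewrite in_itv/= => /dF[].
have dFoo x : x \in `]a, b[%R -> is_derive x 1 F (f x).
  by move=> xab; apply: dF; move: xab; rewrite in_itv/= => /andP[/ltW-> /ltW->].
rewrite EFinB; apply: continuous_FTC2 => //.
- by have [_ ? ?] := (continuous_within_itvP F ab).1 cF; split => // x /dFoo[].
- by move=> x /dFoo h; rewrite derive1E derive_val.
Qed.

(** Monotone convergence along compact intervals that avoid 0; the upper end [n + 2] keeps even the
    first of them, [[1, 2]], nondegenerate. *)
Lemma cvg_integral_exhaustion_pos (f : R -> \bar R) :
    measurable_fun `](0:R), +oo[ f -> (forall t, 0 < t -> (0 <= f t)%E) ->
  (\int[mu]_(t in `[(n.+1%:R^-1 : R)%R, (n.+2%:R : R)%R]) f t @[n --> \oo] -->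
   \int[mu]_(t in `](0:R)%R, +oo[) f t)%E.
Proof.
move=> mf f0.
have sub n (t : R) : `[n.+1%:R^-1, n.+2%:R] t -> 0 < t.
  by rewrite /= in_itv/= => /andP[+ _]; apply: lt_le_trans; rewrite invr_gt0.
rewrite (_ : `](0:R), +oo[ = \bigcup_n `[n.+1%:R^-1, n.+2%:R]); last first.
  apply/seteqP; split => [t|t [n _ /sub]]; last by rewrite /= in_itv/= andbT.
  rewrite /= in_itv/= andbT => t0.
  near \oo => n; exists n => //=; rewrite in_itv/=; apply/andP; split.
    by apply/ltW; near: n; exact: (near_infty_natSinv_lt (PosNum t0)).
  rewrite (@le_trans _ _ n%:R)// ?ler_nat ?leqW//.
  by near: n; exact: nbhs_infty_ger.
apply: ge0_nondecreasing_set_cvg_integral => //.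
- move=> m n mn; rewrite subsetEset => t; rewrite /= !in_itv/= => /andP[h1 h2].
  rewrite (le_trans _ h1)/= ?(le_trans h2)// ?ler_nat//.
  by rewrite lef_pV2 ?posrE// ler_nat ltnS.
- move=> n; apply: measurable_funS mf => // t /sub.
  by rewrite /= in_itv/= andbT.
- by move=> n t /sub /f0.
Unshelve. all: by end_near. Qed.

Lemma integral_expRN (k : R) : 0 < k ->
  (\int[mu]_(t in `](0:R)%R, +oo[) (expR (- (k * t)))%:E = k^-1%:E)%E.
Proof.
move=> k0; pose F t := - k^-1 * expR (- (k * t)).
have dF (t : R) : is_derive t 1 F (expR (- (k * t))).
  apply: is_derive_eq; rewrite /GRing.scale/=; field; exact: lt0r_neq0.
have df (t : R) : derivable (fun t => expR (- (k * t))) t 1 by [].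
rewrite integral_itv_obnd_cbnd; last first.
  apply/measurable_EFinP; apply: measurable_funTS.
  apply: measurableT_comp; first exact: measurable_expR.
  by apply: measurableT_comp => //; exact: measurable_funM.
rewrite (@ge0_continuous_FTC2y _ _ F _ 0).
- by rewrite /F mulr0 oppr0 expR0 mulr1 -EFinB sub0r opprK.
- by move=> t _; exact: expR_ge0.
- by apply: derivable_within_continuous.
- rewrite -[X in _ --> X](mulr0 (- k^-1)); apply: cvgM; first exact: cvg_cst.
  have ky : (k * r : R) @[r --> +oo] --> +oo by apply: gt0_cvgMry.
  exact: (cvg_comp _ _ ky (@cvgr_expR R)).
- by [].
- apply: cvg_at_right_filter; apply: differentiable_continuous.
  by apply/derivable1_diffP.
- by move=> t _; rewrite derive1E derive_val.
Qed.

Lemma powR_le_expR (s : R) :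
  exists2 C, 0 < C & forall t : R, 1 <= t -> t `^ s <= C * expR (t / 2).
Proof.
pose m := Num.truncn s.
(* The constant makes [t^(m+1)] at most [C] times the single term [(t/2)^(m+1) / (m+1)!] of the
   exponential series; [s < m + 1] holds for negative [s] too, where [m = 0]. *)
exists (2 ^+ m.+1 * m.+1`!%:R); first by rewrite mulr_gt0// ?exprn_gt0// ltr0n fact_gt0.
move=> t t1; have t0 : 0 <= t by exact: le_trans t1.
rewrite (@le_trans _ _ (t ^+ m.+1))//.
  by rewrite -powR_mulrn// ler_powR//; exact/ltW/truncnS_gt.
have /(expR_ge1Dxn m) h : 0 <= t / 2 by rewrite divr_ge0.
have {h} : (t / 2) ^+ m.+1 / (m.+1)`!%:R <= expR (t / 2) by rewrite (le_trans _ h)// lerDr.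
rewrite ler_pdivrMr ?ltr0n ?fact_gt0// expr_div_n ler_pdivrMr ?exprn_gt0//.
by rewrite mulrC (mulrC (expR _)) mulrA.
Qed.

End improper_integrals.

(** * The gamma function: functional equation, finiteness, positivity, factorials *)

Section gamma.
Context {R : realType}.
Notation mu := (@lebesgue_measure R).
Implicit Types s t : R.

Definition gammaI s t : R := t `^ (s - 1) * expR (- t).

Lemma gammaI_ge0 s t : 0 <= gammaI s t.
Proof. by rewrite mulr_ge0 ?powR_ge0 ?expR_ge0. Qed.

Lemma measurable_gammaI s D : measurable_fun D (gammaI s).
Proof.
apply: measurable_funM; first by apply: measurable_funTS; exact: measurable_powR.
by apply: measurable_funTS; apply: measurableT_comp => //; exact: measurable_expR.
Qed.

(** Integration by parts in differential form: integrating this identity yields the functional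
    equation. *)
Lemma is_derive_gammaI s t : 0 < t ->
  is_derive t 1 (gammaI (s + 1)) (s * gammaI s t - gammaI (s + 1) t).
Proof.
move=> t0.
have h1 : is_derive t 1 (fun u => u `^ (s + 1 - 1)) (s * t `^ (s - 1)).
  by rewrite addrK; exact: is_derive1_powR.
have h2 : is_derive t 1 (fun u => expR (- u)) (- expR (- t)).
  by apply: is_derive_eq; rewrite mulrN1.
apply: (is_derive_eq (is_deriveM h1 h2)).
by rewrite /gammaI /GRing.scale/=; ring.
Qed.

Lemma derivable_gammaI s t : 0 < t -> derivable (gammaI s) t 1.
Proof.
by move=> t0; rewrite -(subrK 1 s); have [] := is_derive_gammaI (s - 1) t0.
Qed.

(** Kept in the extended reals so that the functional equation can be proved before finiteness is
    known. *)
Definition egamma s : \bar R := (\int[mu]_(t in `](0:R)%R, +oo[) (gammaI s t)%:E)%E.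

Lemma GammaE s : Gamma s = fine (egamma s).
Proof. by []. Qed.

Lemma egamma_ge0 s : (0 <= egamma s)%E.
Proof. by apply: integral_ge0 => t _; rewrite lee_fin gammaI_ge0. Qed.

Lemma integral_gammaIS s (a b : R) : 0 < a -> a < b ->
  (s%:E * \int[mu]_(t in `[a, b]) (gammaI s t)%:E =
   \int[mu]_(t in `[a, b]) (gammaI (s + 1) t)%:E + (gammaI (s + 1) b - gammaI (s + 1) a)%:E)%E.
Proof.
move=> a0 ab.
have ig r : mu.-integrable `[a, b] (EFin \o gammaI r).
  apply: continuous_compact_integrable; first exact: segment_compact.
  apply: derivable_within_continuous => t; rewrite in_itv/= => /andP[at_ _].
  by apply: derivable_gammaI; exact: lt_le_trans at_.
have <- : (\int[mu]_(t in `[a, b]) (s * gammaI s t - gammaI (s + 1) t)%:E =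
    (gammaI (s + 1) b - gammaI (s + 1) a)%:E)%E.
  apply: FTC2_is_derive => // t /andP[at_ _]; have t0 : 0 < t by exact: lt_le_trans at_.
    exact: is_derive_gammaI.
  apply: derivableB; last exact: derivable_gammaI.
  by apply: derivableM => //; exact: derivable_gammaI.
under [X in (_ + X)%E]eq_integral do rewrite EFinB EFinM.
rewrite integralB//=; last 2 first.
- by apply: integrableZl => //; exact: ig.
- exact: ig.
have -> : (\int[mu]_(x in `[a, b]) (s%:E * (gammaI s x)%:E) =
    s%:E * \int[mu]_(x in `[a, b]) (gammaI s x)%:E)%E.
  by apply: integralZl => //; exact: ig.
rewrite addeC subeK//.
exact: (integrable_fin_num _ (ig _)).
Qed.

(** Half of the exponential decay absorbs the power, leaving the bound [C * expR (- t / 2)]. *)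
Lemma gammaI_cvgy s : gammaI s n.+2%:R @[n --> \oo] --> 0.
Proof.
have [C C0 hC] := powR_le_expR (s - 1).
apply: (squeeze_cvgr (f := cst 0) (h := fun n => C * expR (- (2^-1 * n.+2%:R)))).
- near=> n; rewrite gammaI_ge0/= (_ : - (_ * _) = n.+2%:R / 2 - n.+2%:R); last by field.
  by rewrite expRD mulrA ler_wpM2r ?expR_ge0// hC// ler1n.
- exact: cvg_cst.
- rewrite -[X in _ --> X](mulr0 C); apply: cvgM; first exact: cvg_cst.
  have h : (n.+2%:R : R) @[n --> \oo] --> +oo.
    by move: (@cvgr_idn R); rewrite -(cvg_shiftn 2); under eq_fun do rewrite addn2.
  have half : (2^-1 * r : R) @[r --> +oo] --> +oo by apply: gt0_cvgMry.
  exact: (cvg_comp _ _ h (cvg_comp _ _ half (@cvgr_expR R))).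
Unshelve. all: by end_near. Qed.

Lemma gammaI_cvg0 s : 0 < s -> gammaI (s + 1) n.+1%:R^-1 @[n --> \oo] --> 0.
Proof.
move=> s0.
have /(_ (@harmonic R)) h := (cvg_at_rightP _ _ _).1 (powR_cvg0 s0).
apply: (squeeze_cvgr (f := cst 0) (h := fun n => n.+1%:R^-1 `^ s)).
- near=> n; rewrite gammaI_ge0/= /gammaI addrK ler_piMr ?powR_ge0// expR_le1 oppr_le0.
- exact: cvg_cst.
- by apply: h; split; [move=> n; exact: harmonic_gt0|exact: cvg_harmonic].
Unshelve. all: by end_near. Qed.

(** Both sides are limits of the identity on [[1/(n+1), n+2]], whose boundary term [e n] vanishes.
    The limit 0 being finite, the sum of limits makes sense even if an integral is infinite. *)
Lemma egammaS s : 0 < s -> (s%:E * egamma s = egamma (s + 1))%E.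
Proof.
move=> s0.
pose A r n : \bar R :=
  (\int[mu]_(t in `[(n.+1%:R^-1 : R)%R, (n.+2%:R : R)%R]) (gammaI r t)%:E)%E.
pose e n : R := gammaI (s + 1) n.+2%:R - gammaI (s + 1) n.+1%:R^-1.
have cA r : A r n @[n --> \oo] --> egamma r.
  apply: cvg_integral_exhaustion_pos => [|t _]; last by rewrite lee_fin gammaI_ge0.
  by apply/measurable_EFinP; exact: measurable_gammaI.
have ce : (e n)%:E @[n --> \oo] --> 0%E.
  apply: cvg_EFin; first exact: nearW.
  rewrite -[X in _ --> X](subr0 0); apply: cvgB; first exact: gammaI_cvgy.
  exact: gammaI_cvg0.
have Ae : (fun n => s%:E * A s n)%E = (fun n => A (s + 1)%R n + (e n)%:E)%E.
  apply/funext => n; apply: integral_gammaIS => //.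
  by rewrite (@le_lt_trans _ _ 1) ?ltr1n// invf_le1// ler1n.
have h1 : (s%:E * A s n)%E @[n --> \oo] --> (s%:E * egamma s)%E.
  exact: cvgeZl (cA s).
have h2 : (A (s + 1)%R n + (e n)%:E)%E @[n --> \oo] --> (egamma (s + 1) + 0)%E.
  by apply: cvgeD (cA (s + 1)) ce; rewrite fin_num_adde_defl.
by rewrite -[RHS]adde0; apply: cvg_unique h2 => //; rewrite -Ae.
Qed.

(* For [s < 1] finiteness is read off the functional equation, since
   [egamma s] may be infinite there a priori. *)
Lemma egamma_lty s : 0 < s -> (egamma s < +oo)%E.
Proof.
have lty1 r : 1 <= r -> (egamma r < +oo)%E.
  move=> r1; have [C C0 hC] := powR_le_expR (r - 1).
  (* [C] serves for [1 <= t]; the added 1 serves for [t <= 1], where [t^(r-1) <= 1]. *)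
  pose f t : R := (C + 1) * expR (- (t / 2)).
  have me : measurable_fun `](0:R), +oo[ (fun t : R => expR (- (t / 2))).
    apply: measurable_funTS; apply: measurableT_comp; first exact: measurable_expR.
    by apply: measurableT_comp => //; exact: measurable_funM.
  have mf : measurable_fun `](0:R), +oo[ f by exact: measurable_funM.
  apply: (@le_lt_trans _ _ (\int[mu]_(t in `](0:R)%R, +oo[) (f t)%:E)%E); last first.
    under eq_integral do rewrite EFinM.
    rewrite ge0_integralZl_EFin//; [|exact/measurable_EFinP|by rewrite addr_ge0// ltW].
    under eq_integral do rewrite mulrC.
    by rewrite integral_expRN// -EFinM ltry.
  apply: ge0_le_integral => //=.
  - by move=> t _; rewrite lee_fin gammaI_ge0.
  - by apply/measurable_EFinP; exact: measurable_gammaI.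
  - exact/measurable_EFinP.
  move=> t; rewrite in_itv/= andbT => t0; rewrite lee_fin /f.
  rewrite (_ : - (t / 2) = t / 2 - t); last by field.
  rewrite expRD mulrA ler_wpM2r ?expR_ge0//.
  have [t1|/ltW t1] := leP 1 t.
    by rewrite (le_trans (hC _ t1))// ler_wpM2r ?expR_ge0// lerDl.
  rewrite (@le_trans _ _ 1)//.
    by rewrite (le_trans (ge0_ler_powR _ _ _ t1)) ?powR1 ?subr_ge0 ?nnegrE// ltW.
  rewrite -[leLHS]mulr1 ler_pM//; first by rewrite lerDr ltW.
  by rewrite -expR0 ler_expR divr_ge0// ltW.
move=> s0; have : (s%:E * egamma s < +oo)%E by rewrite egammaS// lty1// lerDr ltW.
have := egamma_ge0 s; case: (egamma s) => // [r _ _|]; first exact: ltry.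
by rewrite gt0_muley ?lte_fin.
Qed.

Lemma integrable_gammaI s : 0 < s -> mu.-integrable `]0, +oo[ (EFin \o gammaI s).
Proof.
move=> s0; apply/integrableP; split.
  by apply/measurable_EFinP; exact: measurable_gammaI.
under eq_integral do rewrite /= ger0_norm ?gammaI_ge0//.
exact: egamma_lty.
Qed.

Lemma GammaS s : 0 < s -> Gamma (s + 1) = s * Gamma s.
Proof.
by move=> s0; rewrite !GammaE -egammaS// fineM// ge0_fin_numE ?egamma_ge0// egamma_lty.
Qed.

Lemma Gamma_gt0 s : 0 < s -> 0 < Gamma s.
Proof.
move=> s0; rewrite GammaE fine_gt0// egamma_lty// andbT.
(* A lower bound of the integrand on [[1, 2]]: there [t^(s-1) >= t^(-1) >= 1/2] since [s > 0], and
   [expR (- t) >= expR (- 2)]. *)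
pose c : R := 2^-1 * expR (- 2).
apply: (@lt_le_trans _ _ (\int[mu]_(t in `[1%R, 2%R]) c%:E)%E).
  rewrite integral_cst//= lebesgue_measure_itv/= lte_fin ltr1n /=.
  by rewrite -EFinB -EFinM lte_fin mulr_gt0// ?subr_gt0 ?ltr1n// mulr_gt0 ?expR_gt0.
apply: (@le_trans _ _ (\int[mu]_(t in `[1%R, 2%R]) (gammaI s t)%:E)%E).
  apply: ge0_le_integral => //=.
  - by move=> t _; rewrite lee_fin mulr_ge0 ?expR_ge0.
  - by apply/measurable_EFinP; exact: measurable_gammaI.
  - move=> t; rewrite in_itv/= => /andP[t1 t2]; rewrite lee_fin /gammaI.
    have t0 : 0 < t by exact: lt_le_trans t1.
    rewrite ler_pM ?expR_ge0// ?ler_expR ?lerN2//.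
    rewrite (@le_trans _ _ (t `^ (-1)))//; last by rewrite ler_powR// lerBrDl subrr ltW.
    by rewrite powR_inv1 ?(ltW t0)// lef_pV2 ?posrE.
apply: ge0_subset_integral => //.
- by apply/measurable_EFinP; exact: measurable_gammaI.
- by move=> t _; rewrite lee_fin gammaI_ge0.
- by move=> t; rewrite /= !in_itv/= => /andP[+ _]; rewrite andbT; exact: lt_le_trans.
Qed.

Lemma Gamma1 : Gamma (1 : R) = 1.
Proof.
rewrite GammaE /egamma; under eq_integral do rewrite /gammaI subrr powRr0 mul1r.
under eq_integral do rewrite -[X in expR (- X)]mul1r.
by rewrite integral_expRN// invr1.
Qed.

Lemma Gamma_fact n : Gamma (n.+1%:R : R) = n`!%:R.
Proof.
elim: n => [|n IH]; first exact: Gamma1.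
by rewrite -natr1 GammaS ?ltr0n// IH -natrM.
Qed.

End gamma.

(** * Bounds on the coefficients *)

Section acoef.
Context {R : realType}.
Notation mu := (@lebesgue_measure R).

(** Pointwise [t^(u-1) <= t^n + t^(n+1)]: the second power dominates for [t >= 1], the first for
    [t <= 1]. *)
Lemma Gamma_le_nat n (u : R) : n.+1%:R <= u <= n.+2%:R ->
  Gamma u <= Gamma n.+1%:R + Gamma n.+2%:R.
Proof.
move=> /andP[nu un].
have u0 : 0 < u by rewrite (lt_le_trans _ nu).
rewrite /Gamma -RintegralD//; try exact: integrable_gammaI.
apply: le_Rintegral => //; first exact: integrable_gammaI.
  apply: (@integrableD _ _ _ mu _ _ (EFin \o gammaI n.+1%:R) (EFin \o gammaI n.+2%:R)) => //.
    exact: integrable_gammaI.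
  exact: integrable_gammaI.
move=> t; rewrite /= in_itv/= andbT => t0; rewrite -mulrDl ler_wpM2r ?expR_ge0//.
have [t1|/ltW t1] := leP 1 t.
  by rewrite (@le_trans _ _ (t `^ (n.+2%:R - 1)))// ?lerDr ?powR_ge0// ler_powR// lerD2r.
by rewrite (@le_trans _ _ (t `^ (n.+1%:R - 1)))// ?lerDl ?powR_ge0// ger_powR ?t0// lerD2r.
Qed.

Lemma acoefS (alpha : R) k : acoef alpha k.+1 =
  acoef alpha k * (Gamma ((2 * k.+1 + 1)%:R - alpha) / Gamma (2 * k.+1 + 2)%:R).
Proof. by rewrite /acoef big_nat_recr. Qed.

Lemma acoef0 (alpha : R) : acoef alpha 0 = 1.
Proof. by rewrite /acoef big_nil. Qed.

(** The new factor is at most [((2k+1)! + (2k+2)!) / (2k+3)! = 1 / (2k+2) <= 1 / (k+1)]. *)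
Lemma acoef_bound (alpha : R) k : 0 < alpha -> alpha <= 1 ->
  0 <= acoef alpha k <= k`!%:R^-1.
Proof.
move=> a0 a1; elim: k => [|k /andP[IH0 IH1]]; first by rewrite acoef0 invr1 lexx ler01.
(* Since [0 < alpha <= 1], the argument [2k + 3 - alpha] lies between consecutive integers, as
   [Gamma_le_nat] requires. *)
have arg : (2 * k).+2%:R <= (2 * k.+1 + 1)%:R - alpha <= (2 * k).+3%:R.
  rewrite (_ : (2 * k).+2%:R = (2 * k.+1 + 1)%:R - 1); last first.
    by rewrite mulnS natrD addrK.
  rewrite lerD2l lerN2 a1/= (_ : (2 * k).+3 = (2 * k.+1 + 1)%N) ?addn1 ?mulnS//.
  by rewrite gerDl oppr_le0 ltW.
have G0 : 0 < Gamma ((2 * k.+1 + 1)%:R - alpha).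
  by apply: Gamma_gt0; case/andP: arg => + _; apply: lt_le_trans.
have G1 : 0 < Gamma ((2 * k.+1 + 2)%:R : R) by rewrite Gamma_gt0// addn2.
rewrite acoefS mulr_ge0 ?divr_ge0 ?(ltW G0) ?(ltW G1)//=.
rewrite factS [(k.+1 * _)%N]mulnC natrM invfM ler_pM// ?divr_ge0 ?(ltW G0) ?(ltW G1)//.
rewrite ler_pdivrMr// mulrC ler_pdivlMr//.
have /(le_trans _) := Gamma_le_nat arg.
rewrite (_ : 2 * k.+1 + 2 = (2 * k).+4)%N; last by rewrite addn2 mulnS.
rewrite !Gamma_fact.
move=> h; apply: (@le_trans _ _ (((2 * k).+1`!%:R + (2 * k).+2`!%:R) * k.+1%:R)).
  by rewrite ler_wpM2r// h.
rewrite -natrD -natrM ler_nat [_.+3`!]factS [_.+2`!]factS.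
rewrite -[X in ((X + _) * _)%N]mul1n -mulnDl add1n -mulnA leq_mul2l [X in (X <= _)%N]mulnC.
by rewrite leq_mul2r ltnS leqW ?leq_pmull// !orbT.
Qed.

End acoef.

(** * Fractional integrals of monomials and power series *)

Section riemann_liouville.
Context {R : realType}.
Notation mu := (@lebesgue_measure R).

Lemma measurable_powR_kernel (x s : R) D :
  measurable_fun D (fun t : R => (x - t) `^ (s - 1)).
Proof.
apply: measurable_funTS.
apply: (@measurableT_comp _ _ _ _ _ _ (fun u : R => u `^ (s - 1))).
  exact: measurable_powR.
exact: measurable_funB.
Qed.

(** For [s < 1] the kernel is singular at [t = x], so the antiderivative is used on [[0, b n]] only
    and monotone convergence reaches [x]. *)
Lemma integral_powR_kernel (x s : R) : 0 < x -> 0 < s ->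
  (\int[mu]_(t in `[0%R, x]) ((x - t) `^ (s - 1))%:E = (x `^ s / s)%:E)%E.
Proof.
move=> x0 s0.
(* Increases to [x]; the shift by 2 makes [b 0 = x / 2] already positive. *)
pose b n : R := x - x / n.+2%:R.
have b0 n : 0 < b n.
  by rewrite /b subr_gt0 ltr_pdivrMr// ltr_pMr// ltr1n.
have bx n : b n < x by rewrite /b gtrBl divr_gt0.
have mf D : measurable_fun D (fun t : R => (x - t) `^ (s - 1)).
  exact: measurable_powR_kernel.
have In n : (\int[mu]_(t in `[0%R, b n]) ((x - t) `^ (s - 1))%:E =
    (x `^ s / s - (x / n.+2%:R) `^ s / s)%:E)%E.
  pose F (t : R) := - ((x - t) `^ s / s).
  have d1 (p t : R) : t < x -> is_derive t 1 (fun t => (x - t) `^ p) (- (p * (x - t) `^ (p - 1))).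
    move=> tx; have /(is_derive1_powR p) h : 0 < x - t by rewrite subr_gt0.
    have h2 : is_derive t 1 (fun t : R => x - t) (- 1).
      by apply: is_derive_eq; rewrite add0r mul1r.
    rewrite -[X in is_derive _ _ _ X]mulrN1.
    exact (@is_derive1_comp R (fun u => u `^ p) (fun t => x - t) t _ _ h h2).
  rewrite (_ : x `^ s / s - _ = F (b n) - F 0); last first.
    by rewrite /F /b opprK subr0 subKr addrC.
  apply: FTC2_is_derive => //.
  - move=> t /andP[_ tb]; have tx : t < x by exact: le_lt_trans (bx n).
    have := is_deriveN (is_deriveM (d1 s t tx) (is_derive_cst s^-1 t 1)).
    by move=> /is_derive_eq; apply; rewrite /GRing.scale/=; field; exact: lt0r_neq0.
  - move=> t /andP[_ tb]; have tx : t < x by exact: le_lt_trans (bx n).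
    by have [] := d1 (s - 1) t tx.
have cvgI : (\int[mu]_(t in `[0%R, b n]) ((x - t) `^ (s - 1))%:E)%E @[n --> \oo] -->
    (\int[mu]_(t in `[0%R, x[) ((x - t) `^ (s - 1))%:E)%E.
  rewrite (_ : `[0, x[ = \bigcup_n `[0, b n]); last first.
    apply/seteqP; split => t; last first.
      by move=> [n _]; rewrite /= !in_itv/= => /andP[-> /le_lt_trans]; apply.
    rewrite /= in_itv/= => /andP[t0 tx].
    have e0 : 0 < (x - t) / x by rewrite divr_gt0// subr_gt0.
    near \oo => n; exists n => //=; rewrite in_itv/= t0/= /b lerBrDl -lerBrDr.
    rewrite mulrC -ler_pdivlMr// (@le_trans _ _ n.+1%:R^-1)//.
      by rewrite lef_pV2 ?posrE// ler_nat.
    by apply/ltW; near: n; exact: (near_infty_natSinv_lt (PosNum e0)).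
  apply: ge0_nondecreasing_set_cvg_integral => //.
  - move=> m n mn; rewrite subsetEset => t; rewrite /= !in_itv/= => /andP[-> h]/=.
    rewrite (le_trans h)// lerD2l lerN2 ler_pM2l// lef_pV2 ?posrE// ler_nat.
    exact: mn.
  - by move=> n; apply/measurable_EFinP; exact: mf.
  - by move=> n t _; rewrite lee_fin powR_ge0.
(* The endpoint [x], where the power is conventional, is a null set. *)
rewrite -integral_itv_bndo_bndc; last by apply/measurable_EFinP; exact: mf.
apply: cvg_unique cvgI _ => //.
rewrite (funext In); apply: cvg_EFin; first exact: nearW.
rewrite -[X in _ --> X]subr0 -[X in _ --> _ - X](mul0r s^-1).
apply: cvgB; first exact: cvg_cst.
apply: cvgM; last exact: cvg_cst.
have /(_ (fun n => x / n.+2%:R)) := (cvg_at_rightP _ _ _).1 (powR_cvg0 s0).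
apply; split=> [n|]; first by rewrite divr_gt0.
rewrite -[X in _ --> X](mulr0 x); apply: cvgM; first exact: cvg_cst.
have := @cvg_harmonic R; rewrite -(cvg_shiftS (@harmonic R)).
exact.
Unshelve. all: by end_near. Qed.

(** The integrand of the Riemann-Liouville integral of order [s] of [t^m], without the factor
    [1 / Gamma s]. *)
Definition rl_monomial m (s x t : R) : R := t ^+ m * (x - t) `^ (s - 1).

Lemma integrable_powR_kernel (x s : R) : 0 < x -> 0 < s ->
  mu.-integrable `[0, x] (EFin \o fun t => (x - t) `^ (s - 1)).
Proof.
move=> x0 s0; apply/integrableP; split.
  by apply/measurable_EFinP; exact: measurable_powR_kernel.
under eq_integral do rewrite /= ger0_norm ?powR_ge0//.
by rewrite integral_powR_kernel// ltry.
Qed.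

(** Domination by [M] times the kernel; it supplies integrability for monomials, for sums of power
    series and for the dominating function itself. *)
Lemma integrable_mul_kernel (h : R -> R) (M x s : R) : 0 < x -> 0 < s ->
    measurable_fun setT h -> (forall t, 0 <= t <= x -> `|h t| <= M) ->
  mu.-integrable `[0, x] (EFin \o fun t => h t * (x - t) `^ (s - 1)).
Proof.
move=> x0 s0 mh hM.
have ig : mu.-integrable `[0, x] (fun t => M%:E * ((x - t) `^ (s - 1))%:E)%E.
  by apply: integrableZl => //; exact: integrable_powR_kernel.
have M0 : 0 <= M by apply: le_trans (hM 0 _); rewrite ?lexx ?(ltW x0).
apply: le_integrable ig => //.
- apply/measurable_EFinP; apply: measurable_funM; first exact: measurable_funTS.
  exact: measurable_powR_kernel.
- move=> t; rewrite /= in_itv/= => t0x; rewrite lee_fin !normrM.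
  by rewrite ler_wpM2r// [leRHS]ger0_norm// hM.
Qed.

Lemma integrable_rl_monomial m (x s : R) : 0 < x -> 0 < s ->
  mu.-integrable `[0, x] (EFin \o rl_monomial m s x).
Proof.
move=> x0 s0; apply: (@integrable_mul_kernel (fun t => t ^+ m) (x ^+ m)) => //.
move=> t /andP[t0 tx].
by rewrite ger0_norm ?exprn_ge0// lerXn2r ?nnegrE ?(ltW x0).
Qed.

(* Induction on [m] through [t = x - (x - t)], which expresses the integral for
   [(m + 1, s)] by those for [(m, s)] and [(m, s + 1)] without integration by
   parts. *)
Lemma Rintegral_rl_monomial m (x s : R) : 0 < x -> 0 < s ->
  \int[mu]_(t in `[0, x]) rl_monomial m s x t =
  m`!%:R * Gamma s / Gamma (s + m.+1%:R) * x `^ (s + m%:R).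
Proof.
(* The induction keeps [s] general because the step calls the hypothesis at [s + 1]. *)
move=> x0; elim: m s => [|m IH] s s0.
  rewrite /rl_monomial; under eq_Rintegral do rewrite expr0 mul1r.
  rewrite /Rintegral integral_powR_kernel//= addr0 mul1r GammaS// mulrC.
  by congr (_ * _); field; rewrite !lt0r_neq0// Gamma_gt0.
have E (t : R) : t \in `[0, x] -> rl_monomial m.+1 s x t = x * rl_monomial m s x t - rl_monomial m (s + 1) x t.
  rewrite inE/= in_itv/= => /andP[_ tx].
  (* Splitting [(x - t)^s = (x - t) * (x - t)^(s-1)] is valid at [t = x] as well, because
     [s > 0]. *)
  rewrite /rl_monomial exprS addrK -(mulr_powRB1 _ s0) ?subr_ge0//; ring.
have -> : \int[mu]_(t in `[0, x]) rl_monomial m.+1 s x t =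
    \int[mu]_(t in `[0, x]) (x * rl_monomial m s x t - rl_monomial m (s + 1) x t).
  by apply: eq_Rintegral => t; exact: E.
rewrite RintegralB//; last 2 first.
- by apply: (@integrableZl _ _ _ mu _ _ x (EFin \o rl_monomial m s x)) => //; exact: integrable_rl_monomial.
- by apply: integrable_rl_monomial => //; rewrite addr_gt0.
rewrite RintegralZl//; last exact: integrable_rl_monomial.
(* Over the common denominator [Gamma (s + m + 2)] the numerators differ by
   [(s + m + 1) - s = m + 1], which turns [m!] into [(m+1)!]. *)
rewrite !IH ?addr_gt0// GammaS//.
have G1 := Gamma_gt0 s0.
have sm : 0 < s + m.+1%:R by rewrite addr_gt0.
have G2 := Gamma_gt0 sm.
rewrite (_ : s + 1 + m.+1%:R = s + m.+1%:R + 1); last by ring.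
rewrite (_ : s + m.+2%:R = s + m.+1%:R + 1); last by rewrite -[m.+2%:R]natr1; ring.
rewrite (_ : s + 1 + m%:R = s + m.+1%:R); last by rewrite -[m.+1%:R]natr1; ring.
rewrite (_ : x `^ (s + m.+1%:R) = x * x `^ (s + m%:R)); last first.
  by rewrite -(mulr_powRB1 (ltW x0) sm) -[m.+1%:R]natr1 addrA addrK.
rewrite GammaS// factS natrM -[m.+1%:R]natr1.
rewrite -[m.+1%:R]natr1 in sm G2 *.
by field; rewrite !lt0r_neq0.
Qed.

End riemann_liouville.

(** * Termwise fractional integration of entire power series *)

Section fractional_integral_pseries.
Context {R : realType}.
Notation mu := (@lebesgue_measure R).

Lemma pseries_bound (d : R^nat) (x t : R) N : entire d -> 0 <= t <= x ->
  `|pseries d t N| <= limn (pseries (fun i => `|d i|) x).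
Proof.
move=> ed /andP[t0 tx]; have x0 := le_trans t0 tx.
apply: (@le_trans _ _ (pseries (fun i => `|d i|) x N)).
  rewrite /pseries /series/= (le_trans (ler_norm_sum _ _ _))// ler_sum// => i _.
  rewrite normrM ler_wpM2l// ger0_norm ?exprn_ge0//.
  by apply: lerXn2r; rewrite ?nnegrE.
apply: nondecreasing_cvgn_le; last exact: entire_norm.
apply/nondecreasing_seqP => n; rewrite /pseries /series/= [leRHS]big_nat_recr//=.
by rewrite lerDl mulr_ge0// exprn_ge0.
Qed.

Lemma measurable_pseries (d : R^nat) : entire d ->
  measurable_fun setT (fun t => limn (pseries d t)).
Proof.
move=> ed; apply: continuous_measurable_fun.
move=> x; apply: differentiable_continuous; apply/derivable1_diffP.
exact: (@smooth_pseries R d ed 0%N x).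
Qed.

Lemma lim_pseries_bound (d : R^nat) (x t : R) : entire d -> 0 <= t <= x ->
  `|limn (pseries d t)| <= limn (pseries (fun i => `|d i|) x).
Proof.
move=> ed tx; rewrite -lim_norm; last exact: ed.
apply: limr_le; first by apply: is_cvg_norm; exact: ed.
by apply: nearW => N; exact: pseries_bound.
Qed.

(** Partial sums integrate exactly by the monomial formula; on [[0, x]] they are bounded by [M], so
    [M] times the kernel dominates and the limit passes under the integral. *)
Lemma cvg_frac_integral_pseries (d : R^nat) (x s : R) :
    entire d -> 0 < x -> 0 < s ->
  series (fun i => d i * (i`!%:R * Gamma s / Gamma (s + i.+1%:R) * x `^ (s + i%:R)))
    @ \oo --> \int[mu]_(t in `[0, x]) (limn (pseries d t) * (x - t) `^ (s - 1)).
Proof.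
move=> ed x0 s0.
pose M := limn (pseries (fun i => `|d i|) x).
have ie : mu.-integrable `[0, x]
    (EFin \o fun t => limn (pseries d t) * (x - t) `^ (s - 1)).
  apply: (@integrable_mul_kernel _ _ M) => //; first exact: measurable_pseries.
  by move=> t tx; exact: lim_pseries_bound.
have IN N : (\int[mu]_(t in `[0%R, x]) (pseries d t N * (x - t) `^ (s - 1))%:E =
    (series (fun i => d i * (i`!%:R * Gamma s / Gamma (s + i.+1%:R) * x `^ (s + i%:R))) N)%:E)%E.
  transitivity (\int[mu]_(t in `[0%R, x])
      (\sum_(0 <= i < N) ((d i)%:E * (rl_monomial i s x t)%:E)))%E.
    apply: eq_integral => t _; rewrite /pseries /series/= mulr_suml -sumEFin.
    by apply: eq_bigr => i _; rewrite /rl_monomial -EFinM mulrA.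
  have ii i : mu.-integrable `[0, x] (fun t => (d i)%:E * (rl_monomial i s x t)%:E)%E.
    by apply: integrableZl => //; exact: integrable_rl_monomial.
  rewrite integral_sum//= /series/= -sumEFin; apply: eq_bigr => i _.
  rewrite integralZl//; last exact: integrable_rl_monomial.
  rewrite EFinM -Rintegral_rl_monomial//; congr (_ * _)%E.
  by rewrite /Rintegral fineK//; apply: integrable_fin_num => //; exact: integrable_rl_monomial.
have h : (\int[mu]_(t in `[0%R, x]) (pseries d t N * (x - t) `^ (s - 1))%:E)%E
    @[N --> \oo] --> (\int[mu]_(t in `[0%R, x]) (limn (pseries d t) * (x - t) `^ (s - 1))%:E)%E.
  have ig : mu.-integrable `[0, x] (EFin \o fun t => M * (x - t) `^ (s - 1)).
    exact: (@integrable_mul_kernel _ (cst M) `|M|).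
  apply: (dominated_cvg _ _ _ _ ig) => //.
  - move=> N; apply/measurable_EFinP; apply: measurable_funM; last exact: measurable_powR_kernel.
    apply: measurable_sum => i; apply: measurable_funM => //.
  - move=> t _; apply: cvg_EFin; first exact: nearW.
    by apply: cvgM; [exact: ed|exact: cvg_cst].
  - move=> N t; rewrite /= in_itv/= => tx; rewrite lee_fin normrM.
    by rewrite [`|_ `^ _|]ger0_norm ?powR_ge0// ler_wpM2r ?powR_ge0// pseries_bound.
rewrite (funext IN) in h.
rewrite -[X in _ --> X]fineK in h; first exact: (fine_cvg h).
exact: (integrable_fin_num _ ie).
Qed.

End fractional_integral_pseries.

(** * The solution *)

Section solution.
Context {R : realType}.
Variables (alpha lambda b1 : R).
Hypotheses (alpha0 : 0 < alpha) (alpha1 : alpha <= 1).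

(** The coefficients of [ysol] on all powers of [x], with zeros at even indices, so that results on
    [pseries] apply; for [n = 2k + 1], [n./2] is [k]. *)
Definition ycoef (n : nat) : R :=
  if odd n then b1 * ((-1) ^+ n./2 * acoef alpha n./2 * lambda ^+ n./2) else 0.

(** By [acoef_bound] the k-th term is at most [|x| * (|lambda| * x^2)^k / k!], an exponential
    series. *)
Lemma is_cvg_series_yterm x : cvgn (series (fun k => `|yterm alpha lambda x k|)).
Proof.
apply: (@series_le_cvg _ _ (fun k => `|x| * exp_coeff (`|lambda| * x ^+ 2) k)) => [k|k|k|].
- exact: normr_ge0.
- by rewrite mulr_ge0// exp_coeff_ge0// mulr_ge0// sqr_ge0.
- have /andP[a0 a1] := acoef_bound k alpha0 alpha1.
  rewrite /yterm !normrM !normrX normrN1 expr1n mul1r (ger0_norm a0).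
  rewrite addn1 exprSr exprM real_normK ?num_real// /exp_coeff/= [(`|_| * _) ^+ _]exprMn.
  rewrite [leLHS](_ : _ = acoef alpha k * (`|lambda| ^+ k * (x ^+ 2) ^+ k * `|x|)); last by ring.
  rewrite [leRHS](_ : _ = k`!%:R^-1 * (`|lambda| ^+ k * (x ^+ 2) ^+ k * `|x|)); last by ring.
  by rewrite ler_wpM2r// !mulr_ge0// exprn_ge0// sqr_ge0.
- by apply: is_cvg_seriesZ; exact: is_cvg_series_exp_coeff.
Qed.

Lemma ycoef_even k : ycoef (2 * k) = 0.
Proof. by rewrite /ycoef oddM. Qed.

Lemma ycoef_odd k : ycoef (2 * k).+1 = b1 * ((-1) ^+ k * acoef alpha k * lambda ^+ k).
Proof. by rewrite /ycoef /= oddM/= mul2n uphalf_double. Qed.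

Lemma sum_odd (V : nmodType) (f : nat -> V) n : (forall k, f (2 * k)%N = 0) ->
  \sum_(0 <= i < 2 * n) f i = \sum_(0 <= k < n) f (2 * k).+1.
Proof.
move=> f0; elim: n => [|n IH]; first by rewrite muln0 !big_nil.
by rewrite mulnS !big_nat_recr//= IH f0 addr0.
Qed.

Lemma ycoef_yterm x k : ycoef (2 * k).+1 * x ^+ (2 * k).+1 = b1 * yterm alpha lambda x k.
Proof. by rewrite ycoef_odd /yterm -mulrA addn1. Qed.

Lemma entire_ycoef : entire ycoef.
Proof.
move=> x; apply: normed_cvg; apply: nondecreasing_is_cvgn.
  by apply/nondecreasing_seqP => n; rewrite /normed_series_of /series/= big_nat_recr//= lerDl.
exists (`|b1| * limn (series (fun k => `|yterm alpha lambda x k|))) => _ [n _ <-].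
rewrite /normed_series_of /series/=.
(* Extending the range to [2 * n] adds nonnegative terms only and leaves exactly [n] odd indices. *)
apply: (@le_trans _ _ (\sum_(0 <= i < 2 * n) `|ycoef i * x ^+ i|)).
  rewrite [leRHS](@big_cat_nat _ _ _ n)//=; last by rewrite leq_pmull.
  by rewrite lerDl sumr_ge0.
rewrite sum_odd; last by move=> k; rewrite ycoef_even mul0r normr0.
under eq_bigr do rewrite ycoef_yterm normrM.
rewrite -mulr_sumr ler_wpM2l//.
apply: (@nondecreasing_cvgn_le _ (series (fun k => `|yterm alpha lambda x k|)) _ _ n).
  by apply/nondecreasing_seqP => m; rewrite /series/= big_nat_recr//= lerDl.
exact: is_cvg_series_yterm.
Qed.

Lemma cvg_sum1 (u : R^nat) l : series u @ \oo --> l ->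
  \sum_(1 <= k < n) u k @[n --> \oo] --> l - u 0.
Proof.
(* The shift discards [n = 0], where the empty sum differs from [series u 0 - u 0]. *)
move=> ul; rewrite -(cvg_shiftS (fun n => \sum_(1 <= k < n) u k)).
rewrite (_ : [sequence _]_n = (fun n => series u n.+1 - u 0)); last first.
  by apply/funext => n; rewrite /series/= [in RHS]big_ltn// addrC addKr.
by apply: cvgB; [rewrite (cvg_shiftS (series u))|exact: cvg_cst].
Qed.

Lemma ysolE : ysol alpha lambda b1 = fun x => limn (pseries ycoef x).
Proof.
apply/funext => x.
have /cvg_ex[Y hY] : cvgn (series (yterm alpha lambda x)).
  by apply: normed_cvg; exact: is_cvg_series_yterm.
rewrite /ysol (cvg_lim _ (cvg_sum1 hY))// acoef0 mul1r.
(* The separate leading term of [ysol] is the term of index 0, so the two pieces recombine into a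
   full series. *)
rewrite (_ : yterm alpha lambda x 0 = x); last first.
  by rewrite /yterm acoef0 !expr0 !mul1r expr1.
rewrite addrC subrK; apply/esym/cvg_lim => //.
have h : cvgn (pseries ycoef x) by exact: entire_ycoef.
(* Along even indices the partial sums of [pseries ycoef] are [b1] times those of [yterm]; this
   subsequence identifies the limit. *)
have h2 : pseries ycoef x (2 * n)%N @[n --> \oo] --> limn (pseries ycoef x).
  exact: (cvg_comp _ _ (@cvg_mulnl 2 isT) h).
rewrite (_ : b1 * Y = limn (pseries ycoef x))//.
apply: cvg_unique h2 => //.
rewrite (_ : (fun n => _) = (fun n => b1 * series (yterm alpha lambda x) n)).
  by apply: cvgM => //; exact: cvg_cst.
apply/funext => n; rewrite /pseries /series/= sum_odd.
  by rewrite mulr_sumr; apply: eq_bigr => k _; rewrite ycoef_yterm.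
by move=> k; rewrite ycoef_even mul0r.
Qed.

(** Both sides vanish for even [n]. For [n = 2k + 1] the quotient of consecutive [acoef] is
    [Gamma (n + 2 - alpha) / Gamma (n + 3)], and the alternating sign gives the minus. *)
Lemma ycoef_rec n :
  ycoef n.+2 * Gamma n.+3%:R = - lambda * ycoef n * Gamma (n.+2%:R - alpha).
Proof.
have [on|en] := boolP (odd n); last first.
  by rewrite /ycoef /= negbK (negbTE en) mulr0 !mul0r.
have [k ->] : exists k, n = (2 * k).+1.
  by exists n./2; rewrite -[LHS]odd_double_half on mul2n.
rewrite (_ : (2 * k).+3 = (2 * k.+1).+1); last by rewrite mulnS.
rewrite !ycoef_odd acoefS addn1 addn2 [(2 * k.+1)%N]mulnS.
rewrite !exprS; field.
by rewrite lt0r_neq0// Gamma_gt0.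
Qed.

(** The recurrence in terms of the coefficients of y'', with [n!] kept as a factor because it is the
    numerator in [Rintegral_rl_monomial]. *)
Lemma pseries_diffs2_ycoef n :
  pseries_diffs (pseries_diffs ycoef) n * n`!%:R =
  - lambda * ycoef n * Gamma (n.+2%:R - alpha).
Proof.
rewrite -ycoef_rec Gamma_fact /pseries_diffs !factS !natrM; ring.
Qed.

(** * The Caputo derivative of the solution *)

Lemma caputo_order1 : alpha < 1 -> caputo_order (1 + alpha) = 2.
Proof.
(* Here [1 <= 1 + alpha < 2]; at [alpha = 1] the truncation jumps to 2. *)
move=> a1; rewrite /caputo_order (@truncn_def _ (1 + alpha) 1)//.
by rewrite lerDl ltW//= -[2%:R]natr1 ltrD2l.
Qed.

(** The exponent in the denominator is [(1 + alpha) - 2 + 1 = alpha], so this is the kernel of order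
    [s = 1 - alpha]. *)
Lemma caputo_integrandE y x t : alpha < 1 -> caputo_integrand (1 + alpha) y x t =
  (y^`(2))%classic t * (x - t) `^ (1 - alpha - 1).
Proof.
move=> a1; rewrite /caputo_integrand caputo_order1//= -powRN.
by congr (_ * _ `^ _); ring.
Qed.

Lemma caputo_defined_ysol x : 0 < x ->
  caputo_defined (1 + alpha) (ysol alpha lambda b1) x.
Proof.
move=> x0; have ey := entire_ycoef.
rewrite ysolE; split; first exact: smooth_pseries.
have [a1 _|a1] := ltP alpha 1; last first.
  (* The order is now the natural number 2, so the integrability clause holds vacuously. *)
  have -> : alpha = 1 by apply/le_anti; rewrite alpha1.
  by rewrite (_ : 1 + 1 = 2%:R)// natrK eqxx.
pose d := iter 2 (@pseries_diffs R) ycoef.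
have ed : entire d by exact: entire_iter.
rewrite (_ : EFin \o _ = EFin \o fun t => limn (pseries d t) * (x - t) `^ (1 - alpha - 1)).
  apply: (@integrable_mul_kernel _ _ (limn (pseries (fun i => `|d i|) x))) => //.
  - by rewrite subr_gt0.
  - exact: measurable_pseries.
  - by move=> t tx; exact: lim_pseries_bound.
by apply/funext => t /=; rewrite caputo_integrandE// (derive1n_pseries _ ey).
Qed.

Lemma caputo_ysol x : 0 < x ->
  caputo (1 + alpha) (ysol alpha lambda b1) x =
  - lambda * x `^ (1 - alpha) * ysol alpha lambda b1 x.
Proof.
move=> x0; have ey := entire_ycoef.
rewrite /caputo ysolE.
pose d := iter 2 (@pseries_diffs R) ycoef.
have ed : entire d by exact: entire_iter.
have [a1|a1] := ltP alpha 1; last first.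
  have a1' : alpha = 1 by apply/le_anti; rewrite alpha1.
  rewrite a1' (_ : 1 + 1 = 2%:R)// natrK eqxx subrr powRr0 mulr1.
  rewrite (derive1n_pseries _ ey) -/d.
  have -> : pseries d x = (fun n => - lambda * pseries ycoef x n).
    apply/funext => n; rewrite /pseries /series/= mulr_sumr; apply: eq_bigr => i _.
    rewrite mulrA; congr (_ * _).
    (* At [alpha = 1] the gamma factor is [Gamma (i + 1) = i!], which cancels on both sides. *)
    have := pseries_diffs2_ycoef i.
    rewrite a1' -[i.+2%:R]natr1 addrK Gamma_fact; apply: mulIf.
    by rewrite pnatr_eq0 -lt0n fact_gt0.
  by apply/cvg_lim => //; apply: cvgM; [exact: cvg_cst|exact: ey].
have -> : (Num.truncn (1 + alpha)) = 1%N by have [] := caputo_order1 a1.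
(* As [alpha > 0], [1 + alpha] differs from its truncation 1, which selects the integral branch. *)
rewrite eq_sym addrC -subr_eq subrr eq_sym gt_eqF// addrC caputo_order1//.
rewrite (_ : 2%:R - (1 + alpha) = 1 - alpha); last by ring.
have s0 : 0 < 1 - alpha by rewrite subr_gt0.
have G0 := Gamma_gt0 s0.
have h := cvg_frac_integral_pseries ed x0 s0.
under eq_Rintegral do rewrite caputo_integrandE// (derive1n_pseries _ ey) -/d.
have h1 : - lambda * x `^ (1 - alpha) * pseries ycoef x n @[n --> \oo] -->
    - lambda * x `^ (1 - alpha) * limn (pseries ycoef x).
  by apply: cvgM; [exact: cvg_cst|exact: ey].
(* Both sides of the equation are limits of one sequence: the partial sums agree term by term. *)
apply: cvg_unique h1 => //.
rewrite (_ : (fun n => _) = (fun n => (Gamma (1 - alpha))^-1 * series (fun i => d i *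
  (i`!%:R * Gamma (1 - alpha) / Gamma (1 - alpha + i.+1%:R) * x `^ (1 - alpha + i%:R))) n)).
  by apply: cvgM => //; exact: cvg_cst.
apply/funext => n; rewrite /pseries /series/= !mulr_sumr; apply: eq_bigr => i _.
have s1 : 0 < 1 - alpha + i.+1%:R by rewrite addr_gt0.
have G1 := Gamma_gt0 s1.
rewrite [x `^ (1 - alpha + _)]powRD; last by rewrite (gt_eqF x0) implybT.
rewrite powR_mulrn; last exact: ltW.
(* The recurrence produces [Gamma (i + 2 - alpha)], which is the denominator of the i-th monomial
   integral and cancels it. *)
have := pseries_diffs2_ycoef i.
rewrite (_ : i.+2%:R - alpha = 1 - alpha + i.+1%:R); last by rewrite -[i.+2%:R]natr1; ring.
rewrite -[pseries_diffs (pseries_diffs ycoef) i]/(d i) => di.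
rewrite [RHS](_ : _ = (d i * i`!%:R) / Gamma (1 - alpha + i.+1%:R) * x `^ (1 - alpha) * x ^+ i).
  by rewrite di; field; exact: lt0r_neq0.
by field; rewrite !lt0r_neq0.
Qed.

End solution.

(** * Convergence, equation and initial values together *)

Unset Implicit Arguments.
Set Strict Implicit.

Theorem theorem3p1 (R : realType) (alpha l E I P lambda b1 : R)
    (halpha0 : 0 < alpha) (halpha1 : alpha <= 1) (hl : 0 < l)
    (hE : 0 < E) (hI : 0 < I) (hP : 0 < P)
    (hlambda : lambda = P / (E * I * Gamma (2 - alpha))) :
  (forall x : R,
     cvgn (fun n : nat => \sum_(1 <= k < n) `|yterm alpha lambda x k|)) /\
  (forall x : R, 0 < x -> x < l ->
     caputo_defined (1 + alpha) (ysol alpha lambda b1) x /\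
     caputo (1 + alpha) (ysol alpha lambda b1) x =
       - lambda * x `^ (1 - alpha) * ysol alpha lambda b1 x) /\
  ysol alpha lambda b1 0 = 0 /\
  derivable (ysol alpha lambda b1) 0 1 /\
  (ysol alpha lambda b1)^`() 0 = b1.
Proof.
(* At 0 the partial sums equal [c 0] once they are nonempty; this yields [y 0] from [ycoef] and
   [y' 0] from its [pseries_diffs]. *)
have lim0 (c : R^nat) : limn (pseries c 0) = c 0.
  apply/cvg_lim => //; apply: cvg_near_cst; near=> n.
  rewrite /pseries /series/= big_ltn//; last by near: n; exact: nbhs_infty_gt.
  rewrite expr0 mulr1 big1_seq ?addr0// => i /=; rewrite mem_index_iota => /andP[i0 _].
  by rewrite expr0n eqn0Ngt i0 mulr0.
have ey : entire (ycoef alpha lambda b1) by exact: entire_ycoef.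
have dy := is_derive_pseries 0 ey.
split.
  move=> x; have /cvg_ex[Y hY] : cvgn (series (fun k => `|yterm alpha lambda x k|)).
    exact: is_cvg_series_yterm.
  by apply/cvg_ex; eexists; exact: cvg_sum1 hY.
split; first by move=> x x0 _; split; [exact: caputo_defined_ysol|exact: caputo_ysol].
rewrite ysolE//; split; first by rewrite lim0.
split; first by case: dy.
rewrite derive1E derive_val lim0 /pseries_diffs mul1r.
by rewrite /ycoef /= acoef0 !expr0 !mulr1.
Unshelve. all: by end_near. Qed.
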